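(* Let $D$ be a connected checkerboard-colored link diagram with at least one crossing and with associated Tait graph $G$. Then the symmetrized Tutte polynomial $\chi_G(t,t)$ of $G$ can be expanded as $$\chi_{G}(t,t)=\sum_{\sigma}\phi_{D}^{\sigma}(t),$$ where the sum is over all states $\sigma$ of $D$ with respect to which $D$ is $\sigma$-adequate, and $\phi_{D}^{\sigma}(t)=\chi_{G|E_{\sigma}}(0,t)\cdot\chi_{G/E_{\sigma}}(t,0)$.
   Context: A link diagram $D\subseteq\mathbb{R}^2$ has a projection graph $\Gamma_D$, obtained by replacing crossings with 4-valent vertices; $D$ is connected if $\Gamma_D$ is connected, and the regions of $D$ are the complementary regions of $\Gamma_D$. $D$ is checkerboard-colored if each region is shaded black or white so that near each crossing two opposite regions are black and the other two opposite regions are white. States. At each crossing one may perform the A-resolution (the smoothing joining the two regions swept out when the over-strand is rotated counterclockwise toward the under-strand) or the B-resolution (the other smoothing). A state $\sigma$ of $D$ is a choice of A- or B-resolution at each crossing. Resolving all crossings according to $\sigma$ gives the state graph $H_\sigma$, consisting of disjoint state circles together with one state segment per crossing, recording the location and type of the resolution. $D$ is $\sigma$-adequate with respect to $\sigma$ if no state segment of $H_\sigma$ connects a state circle to itself. Tait graph. The Tait graph $G$ of a checkerboard-colored diagram $D$ is the plane multigraph with one vertex per black region and one edge per crossing, joining the vertices of the two black regions meeting at that crossing (a loop if the same black region meets the crossing twice). Its edges are signed: an edge is $+$ if the A-resolution of its crossing locally joins the two black regions (so the B-resolution separates them), and $-$ if the B-resolution locally joins the two black regions (so the A-resolution separates them).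 The set $E_\sigma\subseteq E(G)$ is the union of the $+$ edges whose crossings are A-resolved by $\sigma$ and the $-$ edges whose crossings are B-resolved by $\sigma$. For $H\subseteq E(G)$, $G|H$ is the spanning subgraph with all vertices of $G$ and edge set $H$, and $G/H$ is obtained from $G$ by contracting the edges of $H$ (contracting a loop means deleting it). Tutte polynomial. $\chi_G(x,y)$ denotes the Tutte polynomial of a multigraph $G$: $\chi_G=1$ if $G$ has no edges, $\chi_G=x\,\chi_{G/e}$ if $e$ is a bridge, $\chi_G=y\,\chi_{G-e}$ if $e$ is a loop, and $\chi_G=\chi_{G/e}+\chi_{G-e}$ if $e$ is neither; it is multiplicative over disjoint unions and over blocks. The symmetrized Tutte polynomial is its evaluation $\chi_G(t,t)$ at $x=y=t$. *)

(* Defs.v *)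
From HB Require Import structures.
From mathcomp Require Import all_boot all_order all_algebra.

Set Implicit Arguments.
Unset Strict Implicit.
Unset Printing Implicit Defensive.

Import GRing.Theory.
Local Open Scope ring_scope.

(* A multigraph with vertices in V and edges in E, loops and parallel edges
   allowed.  The pair [ends e] is to be read as unordered.  The sets [verts]
   and [edges] shrink under minors while V and E stay fixed. *)
Record mgraph (V E : finType) := MGraph {
  verts : {set V};
  edges : {set E};
  ends : E -> V * V;
  ends_verts : forall e, e \in edges ->
    ((ends e).1 \in verts) && ((ends e).2 \in verts)
}.

Section Multigraphs.
Variables V E : finType.
Implicit Types (G : mgraph V E) (H : {set E}) (e : E).

Definition adj G : rel V := fun u v =>
  [exists e in edges G, (ends G e == (u, v)) || (ends G e == (v, u))].

Fact restrict_subproof G H e : e \in edges G :&: H ->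
  ((ends G e).1 \in verts G) && ((ends G e).2 \in verts G).
Proof. by case/setIP=> eG _; apply: ends_verts. Qed.

(* G|H *)
Definition restrict G H : mgraph V E := MGraph (@restrict_subproof G H).

Definition delete G e : mgraph V E := restrict G [set~ e].

(* The vertex of G/H that u is merged into: a chosen representative of the
   connected component of u in G|H. *)
Definition merge G H : V -> V := fingraph.root (adj (restrict G H)).

Fact contract_subproof G H e : e \in edges G :\: H ->
  (merge G H (ends G e).1 \in merge G H @: verts G) &&
  (merge G H (ends G e).2 \in merge G H @: verts G).
Proof.
by case/setDP=> eG _; case/andP: (ends_verts eG) => u v; rewrite !imset_f.
Qed.

(* G/H; on loops of G in H this is deletion. *)
Definition contract G H : mgraph V E :=
  @MGraph V E (merge G H @: verts G) (edges G :\: H)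
    (fun e => (merge G H (ends G e).1, merge G H (ends G e).2))
    (@contract_subproof G H).

Definition is_loop G e : bool := (ends G e).1 == (ends G e).2.

Definition is_bridge G e : bool :=
  ~~ connect (adj (delete G e)) (ends G e).1 (ends G e).2.

(* Deletion-contraction in Z[y][x]: x is 'X and y is 'Y.  The argument n
   bounds the number of edges; the edge to be removed is an arbitrary one, as
   the Tutte polynomial does not depend on the order of the edges. *)
Fixpoint tutte_rec (n : nat) G : {poly {poly int}} :=
  if n is n'.+1 then
    if [pick e in edges G] is Some e then
      if is_bridge G e then 'X * tutte_rec n' (contract G [set e])
      else if is_loop G e then 'Y * tutte_rec n' (delete G e)
      else tutte_rec n' (contract G [set e]) + tutte_rec n' (delete G e)
    else 1
  else 1.

Definition tutte G : {poly {poly int}} := tutte_rec #|edges G| G.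

(* chi_G(a, b) for a, b in Z[t]. *)
Definition tutte_at G (a b : {poly int}) : {poly int} :=
  (map_poly (map_poly polyC) (tutte G)).[a, b].

End Multigraphs.

(* Half-edges of a 4-valent graph: (c, i) is the i-th half-edge at the
   vertex c in counterclockwise order. *)
Notation dart C := (C * 'Z_4)%type.

Definition rot (C : finType) (x : dart C) : dart C := (x.1, x.2 + 1).

(* The region on the left of the dart x, when one leaves x.1 along x, has a
   corner at x.1 lying between x and rot x; we write that corner as x too.
   Going along the edge of x to its other end, the next corner of the same
   region is the following one. *)
Definition next_corner (C : finType) (arc : dart C -> dart C) (x : dart C) :
  dart C := ((arc x).1, (arc x).2 - 1).

Definition crossing_adj (C : finType) (arc : dart C -> dart C) : rel C :=
  fun c d => [exists i : 'Z_4, (arc (c, i)).1 == d].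

(* A link diagram without crossingless components, up to isotopy: a 4-valent
   combinatorial map where the under-strand at c runs through the half-edges
   (c, 0), (c, 2) and the over-strand through (c, 1), (c, 3).  The involution
   [arc] matches the two half-edges of each edge of the projection graph.
   Planarity is Euler's formula v + f = e + 2k, where f counts the boundary
   walks of regions and k the connected components. *)
Record diagram := Diagram {
  crossing : finType;
  arc : dart crossing -> dart crossing;
  arcK : involutive arc;
  arc_neq : forall x, arc x != x;
  arc_planar :
    (#|crossing| + fcard (next_corner arc) predT =
     fcard arc predT + 2 * n_comp (crossing_adj arc) predT)%N
}.

Section Diagrams.
Variable D : diagram.
Implicit Types (x y : dart (crossing D)) (c : crossing D).
Implicit Types (B : {set {set dart (crossing D)}}).

Definition diagram_connected : Prop :=
  forall c d, connect (crossing_adj (@arc D)) c d.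

(* The region having a corner at x, as its set of corners; these are the
   regions of D when D is connected. *)
Definition region x : {set dart (crossing D)} :=
  [set y | fconnect (next_corner (@arc D)) x y].

Definition regions : {set {set dart (crossing D)}} :=
  [set region x | x : dart (crossing D)].

(* B is the set of black regions. *)
Record checkerboard B : Prop := Checkerboard {
  black_regions : B \subset regions;
  black_alternate : forall x, (region (rot x) \in B) = (region x \notin B)
}.

Definition A_res : bool := true.
Definition B_res : bool := false.

(* Resolution r joins the regions at corner i of the crossing.  Rotating the
   over-strand, on half-edges 1 and 3, counterclockwise onto the under-strand
   sweeps out the corners 1 (between 1 and 2) and 3 (between 3 and 0). *)
Definition joins (r : bool) (i : 'Z_4) : bool := odd i == r.

(* A corner which is not joined is cut off by an arc between its two sides. *)
Definition smooth (r : bool) (i : 'Z_4) : 'Z_4 :=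
  if joins r i then i - 1 else i + 1.

Definition state := {ffun crossing D -> bool}.
Implicit Type s : state.

Definition state_step s : rel (dart (crossing D)) := fun x y =>
  (y == arc x) || (y == (x.1, smooth (s x.1) x.2)).

(* A state circle is the set of half-edges it runs along. *)
Definition state_circle s x : {set dart (crossing D)} :=
  [set y | connect (state_step s) x y].

Fact state_graph_subproof s c : c \in [set: crossing D] ->
  (state_circle s (c, 0) \in [set state_circle s x | x : dart (crossing D)]) &&
  (state_circle s (c, 2) \in [set state_circle s x | x : dart (crossing D)]).
Proof. by move=> _; rewrite !imset_f. Qed.

(* H_s, with state circles as vertices and state segments as edges.  For both
   resolutions the half-edges 0 and 2 lie on the two different arcs that the
   segment connects. *)
Definition state_graph s : mgraph {set dart (crossing D)} (crossing D) :=
  @MGraph _ _ [set state_circle s x | x : dart (crossing D)] setT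
    (fun c => (state_circle s (c, 0), state_circle s (c, 2)))
    (@state_graph_subproof s).

Definition adequate s : bool := [forall c, ~~ is_loop (state_graph s) c].

(* The edge c of the Tait graph is + *)
Definition positive B c : bool :=
  [forall i : 'Z_4, (region (c, i) \in B) ==> joins A_res i].

Definition tait_ends B c : {set dart (crossing D)} * {set dart (crossing D)} :=
  if region (c, 0) \in B then (region (c, 0), region (c, 2))
  else (region (c, 1), region (c, 3)).

Fact tait_subproof B (hB : checkerboard B) c : c \in [set: crossing D] ->
  ((tait_ends B c).1 \in B) && ((tait_ends B c).2 \in B).
Proof.
move=> _; have alt i : (region (c, i + 1) \in B) = (region (c, i) \notin B).
  exact: black_alternate hB (c, i).
have e1 : 0 + 1 = 1 :> 'Z_4 by apply/eqP.
have e2 : 1 + 1 = 2 :> 'Z_4 by apply/eqP.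
have e3 : 2 + 1 = 3 :> 'Z_4 by apply/eqP.
have b1 := alt 0; have b2 := alt 1; have b3 := alt 2.
rewrite {}e1 in b1; rewrite {}e2 in b2; rewrite {}e3 in b3.
by rewrite /tait_ends; case: ifP => /= c0; rewrite ?b3 ?b2 ?b1 c0.
Qed.

Definition tait B (hB : checkerboard B) :
    mgraph {set dart (crossing D)} (crossing D) :=
  @MGraph _ _ B setT (tait_ends B) (@tait_subproof B hB).

(* The set E_s of + edges resolved by A and of - edges resolved by B. *)
Definition state_edges B s : {set crossing D} :=
  [set c | positive B c & s c == A_res] :|:
  [set c | ~~ positive B c & s c == B_res].

Definition phi B (hB : checkerboard B) s : {poly int} :=
  tutte_at (restrict (tait hB) (state_edges B s)) 0 'X *
  tutte_at (contract (tait hB) (state_edges B s)) 'X 0.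

End Diagrams.

(* Main.v *)
Require Import Defs.
From mathcomp Require Import all_boot all_order all_algebra all_fingroup.
From mathcomp Require Import zify.
(* [merge] and [rot] are also names of functions on sequences. *)
Import Defs.

Set Implicit Arguments.
Unset Strict Implicit.
Unset Printing Implicit Defensive.

Import GRing.Theory.
Local Open Scope ring_scope.

(** Identify a set H of edges of the Tait graph G with the state that joins the
    black regions exactly at the crossings in H.

    The identity then has an algebraic half, valid for every multigraph: the
    convolution formula of Kook, Reiner and Stanton
      chi_G(a, b) = sum over all H of chi_(G|H)(0, b) * chi_(G/H)(a, 0).
    Expand both factors as rank generating polynomials, sums over A inside H and
    over C containing H.  The sum over H between A and C is, up to a factor that
    depends on A and C only, an alternating sum over an interval of sets; it
    vanishes unless A = C, and the terms A = C form chi_G(a, b)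
    ([tutte_atE], [rank_poly_convolution]).

    The topological half says that the states which are not adequate contribute
    nothing.  If the segment at c joins a state circle to itself, then either c
    is in H and is a bridge of G|H, or c is not in H and is a loop of G/H; the
    factor chi_(G|H)(0, t) or chi_(G/H)(t, 0) vanishes accordingly.
    Following the state circles with a black region on their left gives a
    permutation of the darts, [walk H].  An orbit of it on black darts stays
    along one component of the black surface G|H, which settles the case of c
    outside H ([orbit_nonloop]).  For c in H planarity is needed.  Putting one
    more crossing into H composes [walk H] with a transposition, hence changes
    the number of orbits by one: downwards whenever the rank of G|H grows, as
    two black components then merge.  So
      (number of orbits) + 2 * rank H - #|H|
    never increases with H.  Euler's formula makes it equal at both ends, the
    empty set and the set of all crossings, so it is constant
    ([orbits_rank]).  Adding c to H without changing the rank, which is what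
    happens when c is not a bridge of G|H, must therefore split an orbit, and the
    segment at c connects two different circles ([orbit_nonbridge]). *)

(** * Finite sets and components of relations *)

Lemma subset_setU1_ind (T : finType) (A : {set T}) (P : {set T} -> Prop) :
    P A ->
    (forall x (B : {set T}), A \subset B -> x \notin B -> P B -> P (x |: B)) ->
  forall B : {set T}, A \subset B -> P B.
Proof.
move=> PA PU B; move: {2}#|_| (leqnn #|B :\: A|) => n.
elim: n B => [|n IHn] B leBn sAB.
  suffices -> : B = A by [].
  apply/eqP; rewrite eqEsubset sAB andbT -setD_eq0 -cards_eq0.
  by rewrite leqn0 in leBn.
have [/eqP|[x]] := set_0Vmem (B :\: A).
  rewrite setD_eq0 => sBA; suffices -> : B = A by [].
  by apply/eqP; rewrite eqEsubset sBA.
case/setDP=> Bx A'x; rewrite -(setD1K Bx).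
have sAB' : A \subset B :\ x by rewrite subsetD1 sAB.
apply: PU; rewrite ?setD11 //; apply: IHn => //.
rewrite setDDl setUC -setDDl.
by move: leBn; rewrite (cardsD1 x (B :\: A)) !inE Bx A'x.
Qed.

Lemma connect_homo (T T' : finType) (e : rel T) (e' : rel T') (f : T -> T') :
    (forall x y, e x y -> connect e' (f x) (f y)) ->
  forall x y, connect e x y -> connect e' (f x) (f y).
Proof.
move=> fe x y /connectP[p]; elim: p x => [|z p IHp] x /=; first by move=> _ ->.
by case/andP=> /fe xz zp /(IHp _ zp); apply: connect_trans.
Qed.

Lemma n_comp_image (T T' : finType) (e : rel T) (c : T -> T') :
  (forall x y, connect e x y = (c x == c y)) -> n_comp e predT = #|c @: T|.
Proof.
move=> ec; have es : connect_sym e by move=> x y; rewrite !ec eq_sym.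
have -> : c @: T = c @: [set x | roots e x].
  apply/setP=> z; apply/imsetP/imsetP=> -[x rx ->]; last by exists x.
  exists (fingraph.root e x); first by rewrite inE roots_root.
  by apply/eqP; rewrite -ec connect_root.
rewrite card_in_imset; first by apply: eq_card => x; rewrite !inE andbT.
move=> x y; rewrite !inE => /eqP rx /eqP ry /eqP.
by rewrite -ec -root_connect // rx ry => /eqP.
Qed.

Lemma n_comp_classes (T : finType) (e : rel T) : connect_sym e ->
  n_comp e predT = #|[set [set y | connect e x y] | x : T]|.
Proof.
move=> es; apply: n_comp_image => x y; apply/idP/eqP=> [xy|/setP/(_ y)].
  by apply/setP=> z; rewrite !inE (same_connect es xy).
by rewrite !inE connect0.
Qed.

Lemma leq_n_comp (T : finType) (e e' : rel T) :
    connect_sym e -> connect_sym e' -> subrel e (connect e') ->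
  (n_comp e' predT <= n_comp e predT)%N.
Proof.
move=> es es' ee'.
have nE f : connect_sym f -> n_comp f predT = #|fingraph.root f @: T|.
  by move=> fs; apply: n_comp_image => x y; rewrite root_connect.
rewrite !nE //.
apply: leq_trans (leq_imset_card (fingraph.root e') (fingraph.root e @: T)).
rewrite subset_leq_card //; apply/subsetP=> _ /imsetP[x _ ->].
apply/imsetP; exists (fingraph.root e x); rewrite ?imset_f //.
by apply/(fingraph.rootP es'); apply: connect_sub ee' _ _ (connect_root _ _).
Qed.

(** The new component map [c] sends the old class of [b] to that of [a]. *)
Lemma n_comp_add_edge (T : finType) (e e' : rel T) a b :
    symmetric e ->
    (forall x y, e' x y = [|| e x y, (a, b) == (x, y) | (a, b) == (y, x)]) ->
  (n_comp e' predT + ~~ connect e a b = n_comp e predT)%N.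
Proof.
move=> es e'E; have ces := sym_connect_sym es; pose r := fingraph.root e.
pose c x := if r x == r b then r a else r x.
have rE x y : (r x == r y) = connect e x y := root_connect ces x y.
have ee' x y : connect e x y -> connect e' x y.
  by apply: connect_sub => {}x {}y exy; apply: connect1; rewrite e'E exy.
have e's : connect_sym e'.
  by apply: sym_connect_sym => x y; rewrite !e'E es; congr orb; apply: orbC.
have ab' : connect e' a b by rewrite connect1 // e'E eqxx orbT.
have e'c x y : connect e' x y = (c x == c y).
  apply/idP/eqP=> [|cxy].
    case/connectP=> p; elim: p x => [|z p IHp] x /=; first by move=> _ ->.
    case/andP=> xz zp /(IHp _ zp) <-; move: xz; rewrite e'E /c.
    case/or3P=> [xz|/eqP[<- <-]|/eqP[<- <-]]; rewrite ?eqxx ?if_same //.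
    by have /eqP-> : r x == r z by rewrite rE connect1.
  have cc z : connect e' z (c z).
    rewrite /c; case: ifP => [|_]; last by apply: ee'; apply: connect_root.
    rewrite rE => zb; apply: connect_trans (ee' _ _ zb) _; rewrite e's.
    apply: connect_trans ab'; rewrite e's; apply: ee'; exact: connect_root.
  by apply: connect_trans (cc x) _; rewrite cxy e's.
rewrite (n_comp_image e'c) (@n_comp_image _ _ e r) => [|*]; last by rewrite rE.
rewrite -rE.
have [ab|ab] := eqVneq (r a) (r b).
  rewrite addn0; congr #|pred_of_set _|; apply: eq_imset => x.
  by rewrite /c ab; case: eqP.
rewrite (cardsD1 (r b) (r @: T)) imset_f // addnC.
congr (_ + #|pred_of_set _|)%N; apply/setP=> z; rewrite !inE.
apply/imsetP/andP=> [[x _ ->]|[zb /imsetP[x _ zx]]].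
  by rewrite /c; case: ifP => [_|->]; rewrite ?ab imset_f.
by exists x; rewrite // /c -zx (negPf zb).
Qed.

Lemma leq_card_invariant (T T' : finType) (s : {perm T}) (k : T -> T') :
  (forall x, k (s x) = k x) -> (#|k @: T| <= #|porbits s|)%N.
Proof.
move=> ks; rewrite -(card_imset _ (@set1_inj T')).
apply: leq_trans (leq_imset_card (fun S : {set T} => k @: S) (porbits s)).
rewrite subset_leq_card //; apply/subsetP=> _ /imsetP[_ /imsetP[x _ ->] ->].
apply/imsetP; exists (porbit s x); first exact: imset_f.
apply/setP=> z; rewrite inE; apply/eqP/imsetP => [->|[y]].
  by exists x; rewrite ?porbit_id.
case/porbitP=> i -> ->; elim: i => [|i <-]; first by rewrite perm1.
by rewrite expgSr permM ks.
Qed.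

(** * Rank of an edge set *)

Section Rank.
Variables V E : finType.
Implicit Types (G : mgraph V E) (A B H : {set E}) (e : E).

Definition linked G A : rel V := connect (adj (restrict G A)).

(** The number of edges of a spanning forest of G|A.  Components are counted over
    the whole type V: vertices outside [verts G] are isolated and cancel out. *)
Definition rank G A : nat := (#|V| - n_comp (adj (restrict G A)) predT)%N.

Lemma adj_sym G : symmetric (adj G).
Proof. by move=> u v; apply: eq_existsb => e; rewrite orbC. Qed.

Lemma linked_sym G A : symmetric (linked G A).
Proof. exact/sym_connect_sym/adj_sym. Qed.

Lemma linked_ends G A e :
  e \in edges G -> e \in A -> linked G A (ends G e).1 (ends G e).2.
Proof.
move=> Ge Ae; apply/connect1/existsP; exists e.
by rewrite /= inE Ge Ae -surjective_pairing eqxx.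
Qed.

Lemma linked_sub G A B u v : A \subset B -> linked G A u v -> linked G B u v.
Proof.
move=> sAB; apply: connect_sub => {}u {}v /exists_inP[e].
rewrite inE => /andP[Ge Ae] uv.
by apply/connect1/exists_inP; exists e; rewrite // inE Ge (subsetP sAB).
Qed.

Lemma linked_set0 G u v : linked G set0 u v = (u == v).
Proof.
apply/idP/eqP=> [/connectP[[_ ->|w p]] //= /andP[]|->]; last exact: connect0.
by case/exists_inP=> e; rewrite /= setI0 inE.
Qed.

Lemma rank_set0 G : rank G set0 = 0%N.
Proof.
rewrite /rank (@n_comp_image _ _ _ id) => [|u v]; last exact: linked_set0.
by rewrite card_imset ?subnn; last exact: inj_id.
Qed.

(** Everything about [rank] follows from this: an edge counts exactly when its
    ends are not yet linked. *)
Lemma rank_setU1 G A e : e \in edges G ->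
  rank G (e |: A) = (rank G A + ~~ linked G A (ends G e).1 (ends G e).2)%N.
Proof.
move=> Ge; set a := _.1; set b := _.2.
have add : (n_comp (adj (restrict G (e |: A))) predT + ~~ linked G A a b =
    n_comp (adj (restrict G A)) predT)%N.
  apply: n_comp_add_edge => [|u v]; first exact: adj_sym.
  rewrite -surjective_pairing; apply/exists_inP/or3P=> /=.
    case=> f; rewrite !inE => /andP[Gf /orP[/eqP->|Af]].
      by case/orP=> ->; [constructor 2 | constructor 3].
    by move=> uv; constructor 1; apply/exists_inP; exists f; rewrite //= inE Gf.
  case=> [/exists_inP[f]|uv|uv].
  - by rewrite /= inE => /andP[Gf Af] uv; exists f; rewrite // !inE Gf Af orbT.
  - by exists e; rewrite ?uv // !inE Ge eqxx.
  - by exists e; rewrite ?uv ?orbT // !inE Ge eqxx.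
have := max_card (predI (roots (adj (restrict G A))) predT).
by rewrite /rank -[#|predI _ _|]/(n_comp _ predT) -add; lia.
Qed.

Lemma rank_sub G A B : A \subset B -> (rank G A <= rank G B)%N.
Proof.
move=> sAB; apply: leq_sub2l; apply: leq_n_comp; try exact: linked_sym.
by move=> u v uv; apply: (linked_sub sAB); apply: connect1.
Qed.

Lemma leq_rank_card G A : A \subset edges G -> (rank G A <= #|A|)%N.
Proof.
move: A (sub0set A); apply: subset_setU1_ind => [|e A _ A'e IHA].
  by rewrite rank_set0.
rewrite subUset sub1set => /andP[Ge /IHA].
by rewrite rank_setU1 // cardsU1 A'e; case: linked; lia.
Qed.

Lemma rank_restrict G H A : rank (restrict G H) A = rank G (H :&: A).
Proof.
congr (_ - _)%N; apply: eq_n_comp; apply: eq_connect => u v.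
by rewrite /adj /= setIA.
Qed.

Lemma connect_merge G H u : linked G H u (merge G H u).
Proof. exact: connect_root. Qed.

Lemma eq_merge G H u v : (merge G H u == merge G H v) = linked G H u v.
Proof. exact/root_connect/linked_sym. Qed.

Lemma linked_contract G H A u v :
  linked (contract G H) A (merge G H u) (merge G H v) = linked G (A :|: H) u v.
Proof.
have sH := subsetUr A H.
have mergeL w : linked G (A :|: H) w (merge G H w).
  by apply: (linked_sub sH); apply: connect_merge.
apply/idP/idP=> [uv|].
  apply: connect_trans (mergeL u) _.
  rewrite -/(linked _ _ _ _) linked_sym; apply: connect_trans (mergeL v) _.
  rewrite -/(linked _ _ _ _) linked_sym.
  move: uv; apply: connect_sub => {}u {}v /exists_inP[e].
  rewrite !inE => /andP[/andP[H'e Ge] Ae].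
  suffices: linked G (A :|: H) (merge G H (ends G e).1) (merge G H (ends G e).2).
    by move=> L /= /orP[] /eqP[<- <-]; rewrite -/(linked _ _ _ _) // linked_sym.
  have endsL : linked G (A :|: H) (ends G e).1 (ends G e).2.
    by rewrite linked_ends // inE Ae.
  apply: connect_trans (connect_trans endsL (mergeL _)).
  by rewrite -/(linked _ _ _ _) linked_sym.
apply: connect_homo u v => u v /exists_inP[e]; rewrite !inE => /andP[Ge AHe] uv.
have [He|H'e] := boolP (e \in H).
  apply: eq_connect0; apply/eqP; rewrite eq_merge.
  by case/orP: uv (linked_ends Ge He) => /eqP-> //=; rewrite linked_sym.
rewrite (negPf H'e) orbF in AHe.
apply/connect1/exists_inP; exists e; first by rewrite !inE H'e Ge.
by case/orP: uv => /eqP /= ->; rewrite eqxx ?orbT.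
Qed.

Lemma rank_contract G H A : A \subset edges G :\: H ->
  (rank (contract G H) A + rank G H = rank G (A :|: H))%N.
Proof.
move: A (sub0set A); apply: subset_setU1_ind => [|e A _ A'e IHA].
  by rewrite rank_set0 set0U.
rewrite subUset sub1set => /andP[GHe /IHA {}IHA].
have Ge : e \in edges G by case/setDP: GHe.
by rewrite rank_setU1 // linked_contract -setUA rank_setU1 // -IHA; lia.
Qed.

End Rank.

(** * The rank generating polynomial *)

Lemma big_subset_setD1 (R : nmodType) (T : finType) (S : {set T}) x
    (F : {set T} -> R) : x \in S ->
  \sum_(A : {set T} | A \subset S) F A =
  \sum_(A : {set T} | A \subset S :\ x) (F A + F (x |: A)).
Proof.
move=> Sx; rewrite [RHS]big_split [RHS]addrC.
rewrite (bigID (fun A : {set T} => x \in A)) /=.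
congr (_ + _); last by apply: eq_bigl => A; rewrite subsetD1.
rewrite (reindex_onto (fun A => x |: A) (fun A => A :\ x)) /=.
  apply: eq_bigl => A; rewrite subUset sub1set Sx setU11 andbT subsetD1 /=.
  congr (_ && _); apply/eqP/idP=> [<-|xA]; first by rewrite setD11.
  by rewrite setU1K.
by move=> A /andP[_ Ax]; rewrite setD1K.
Qed.

Lemma setDUidr (T : finType) (A B : {set T}) :
  B \subset A -> A :\: B :|: B = A.
Proof. by rewrite setUC setDE setUIr setUCr setIT => /setUidPr. Qed.

Section RankPolynomial.
Variables (R : comNzRingType) (V E : finType).
Implicit Types (G : mgraph V E) (A B C H : {set E}) (e : E) (u v : R).

(** With u = x - 1 and v = y - 1 these are the terms of Whitney's expansion of
    the Tutte polynomial. *)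
Definition rank_term G u v A : R :=
  u ^+ (rank G (edges G) - rank G A) * v ^+ (#|A| - rank G A).

Definition rank_poly G u v : R :=
  \sum_(A : {set E} | A \subset edges G) rank_term G u v A.

Lemma rank_poly_split G u v e : e \in edges G ->
  rank_poly G u v =
  \sum_(A : {set E} | A \subset edges G :\ e)
     (rank_term G u v A + rank_term G u v (e |: A)).
Proof. exact: big_subset_setD1. Qed.

(** Adding a bridge to A raises the rank by one, so the terms of A and of
    [e |: A] differ by a factor u. *)
Lemma rank_poly_bridge_split G u v e : e \in edges G -> is_bridge G e ->
  rank_poly G u v = (u + 1) *
    \sum_(A : {set E} | A \subset edges G :\ e) rank_term G u v (e |: A).
Proof.
move=> Ge bre; rewrite (rank_poly_split _ _ Ge) mulr_sumr.
apply: eq_bigr => A; rewrite subsetD1 => /andP[sA A'e].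
rewrite mulrDl mul1r; congr (_ + _).
have rU : rank G (e |: A) = (rank G A).+1.
  rewrite rank_setU1 // (contraNN _ bre) ?addn1 //; apply: linked_sub.
  by rewrite subsetC sub1set inE.
have le1 : (rank G (e |: A) <= rank G (edges G))%N.
  by apply: rank_sub; rewrite subUset sub1set Ge.
rewrite /rank_term cardsU1 A'e rU in le1 *.
rewrite mulrA -exprS; congr (_ ^+ _ * _ ^+ _); lia.
Qed.

(** Adding a loop to A leaves the rank alone, so the terms of A and of [e |: A]
    differ by a factor v. *)
Lemma rank_poly_loop_split G u v e : e \in edges G -> is_loop G e ->
  rank_poly G u v = (v + 1) *
    \sum_(A : {set E} | A \subset edges G :\ e) rank_term G u v A.
Proof.
move=> Ge lpe; rewrite (rank_poly_split _ _ Ge) mulr_sumr.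
apply: eq_bigr => A; rewrite subsetD1 => /andP[sA A'e].
rewrite addrC mulrDl mul1r; congr (_ + _).
have rU : rank G (e |: A) = rank G A.
  by rewrite rank_setU1 // (eqP lpe) /linked connect0 addn0.
have := leq_rank_card sA.
rewrite /rank_term cardsU1 A'e rU mulrCA -exprS => le1.
congr (_ ^+ _ * _ ^+ _); lia.
Qed.

Lemma rank_poly_delete G u v e : e \in edges G -> ~~ is_bridge G e ->
  rank_poly (delete G e) u v =
  \sum_(A : {set E} | A \subset edges G :\ e) rank_term G u v A.
Proof.
move=> Ge /negPn nbr; have SE : edges (delete G e) = edges G :\ e.
  by rewrite setDE.
have rS : rank G (edges G :\ e) = rank G (edges G).
  rewrite -{2}(setD1K Ge) rank_setU1 //.
  suff -> : linked G (edges G :\ e) (ends G e).1 (ends G e).2 by rewrite addn0.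
  move: nbr; apply: connect_sub => x y xy; apply: connect1.
  by move: xy; rewrite /adj /= setDE setIA setIid.
rewrite /rank_poly SE; apply: eq_bigr => A sA; rewrite /rank_term SE.
have rE B : B \subset edges G :\ e -> rank (delete G e) B = rank G B.
  rewrite subsetD1 => /andP[_ B'e]; rewrite rank_restrict; congr (rank G _).
  by apply/setIidPr; rewrite subsetC sub1set inE.
by rewrite !rE // rS.
Qed.

Lemma rank_poly_contract G u v e : e \in edges G -> ~~ is_loop G e ->
  rank_poly (contract G [set e]) u v =
  \sum_(A : {set E} | A \subset edges G :\ e) rank_term G u v (e |: A).
Proof.
move=> Ge nlp; have r1 : rank G [set e] = 1%N.
  by rewrite -[[set e]]setU0 rank_setU1 // rank_set0 linked_set0 nlp.
apply: eq_bigr => A sA; rewrite /rank_term /=.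
have rE B : B \subset edges G :\ e ->
    rank (contract G [set e]) B = (rank G (e |: B)).-1.
  by move=> /rank_contract; rewrite r1 setUC => <-; rewrite addn1.
rewrite !rE // setD1K // cardsU1.
have -> : e \notin A by move: sA; rewrite subsetD1 => /andP[].
have : (0 < rank G (e |: A))%N by rewrite -r1 rank_sub // subsetUl.
by move=> r0; congr (_ ^+ _ * _ ^+ _); lia.
Qed.

(** Toggling an element of C outside A reverses the sign. *)
Lemma sum_sign_interval (A C : {set E}) : A \subset C ->
  \sum_(H : {set E} | (A \subset H) && (H \subset C)) (-1) ^+ #|H| =
  (if A == C then (-1) ^+ #|A| else 0) :> R.
Proof.
move=> sAC; case: eqVneq => [<-|neAC].
  by rewrite (big_pred1 A) // => H; rewrite /= eqEsubset andbC.
have /properP[_ [e Ce A'e]] : A \proper C by rewrite properEneq neAC.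
rewrite (eq_bigl (fun H => (H \subset C) && (A \subset H))) => [|H]; last first.
  by rewrite andbC.
rewrite big_mkcondr (big_subset_setD1 _ Ce) big1 // => H.
rewrite subsetD1 => /andP[sHC H'e].
have -> : (A \subset e |: H) = (A \subset H).
  apply/idP/idP=> [sA|sA]; last exact: subset_trans sA (subsetUr _ _).
  rewrite -(setU1K H'e) subsetD1 sA; exact: A'e.
by case: ifP; rewrite ?addr0 // cardsU1 H'e exprS mulN1r subrr.
Qed.

Lemma rank_poly_restrictE G H u v : H \subset edges G ->
  rank_poly (restrict G H) u v =
  \sum_(A : {set E} | A \subset H)
     u ^+ (rank G H - rank G A) * v ^+ (#|A| - rank G A).
Proof.
move=> sH; have GH : edges G :&: H = H by apply/setIidPr.
rewrite /rank_poly /= GH; apply: eq_bigr => A sA.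
by rewrite /rank_term /= GH !rank_restrict setIid (setIidPr sA).
Qed.

(** Indexed by C, the union of H and the subset A of the edges of G/H. *)
Lemma rank_poly_contractE G H u v : H \subset edges G ->
  rank_poly (contract G H) u v =
  \sum_(C : {set E} | (H \subset C) && (C \subset edges G))
     u ^+ (rank G (edges G) - rank G C) *
     v ^+ ((#|C| - #|H|) - (rank G C - rank G H)).
Proof.
move=> sH.
rewrite (reindex_onto (fun A => A :|: H) (fun C => C :\: H)) => [|C]; last first.
  by case/andP=> sHC _; rewrite setDUidr.
rewrite /rank_poly /=; apply: eq_big => A.
  rewrite subsetUr subUset sH andbT /= subsetD; congr (_ && _).
  by rewrite setDUl setDv setU0; apply/setDidPl/eqP.
move=> sA; have := rank_contract sA.
have dAH : [disjoint A & H] by move: sA; rewrite subsetD => /andP[].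
have := rank_contract (subxx (edges G :\: H)).
have -> : edges G :\: H :|: H = edges G.
  by rewrite setDUidr.
have : #|A :|: H| = (#|A| + #|H|)%N.
  by rewrite cardsU disjoint_setI0 // cards0 subn0.
rewrite /rank_term /= => -> <- <-; congr (_ ^+ _ * _ ^+ _); lia.
Qed.

(** The Kook-Reiner-Stanton formula; u = -1 and v = -1 stand for x = 0 and
    y = 0. *)
Lemma rank_poly_convolution G u v :
  \sum_(H : {set E} | H \subset edges G)
     rank_poly (restrict G H) (-1) v * rank_poly (contract G H) u (-1) =
  rank_poly G u v.
Proof.
(* The factor of the (A, H, C) term which does not depend on H. *)
pose w A C := v ^+ (#|A| - rank G A) * u ^+ (rank G (edges G) - rank G C) *
  (-1) ^+ (rank G A + rank G C + #|C|).
transitivity (\sum_(A : {set E}) \sum_(C : {set E} | C \subset edges G)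
    \sum_(H : {set E} | (A \subset H) && (H \subset C)) w A C * (-1) ^+ #|H|).
  transitivity (\sum_(H : {set E} | H \subset edges G)
      \sum_(A : {set E} | A \subset H)
      \sum_(C : {set E} | (H \subset C) && (C \subset edges G))
         w A C * (-1) ^+ #|H|).
    apply: eq_bigr => H sH; rewrite rank_poly_restrictE // rank_poly_contractE //.
    rewrite mulr_suml; apply: eq_bigr => A sA; rewrite mulr_sumr.
    apply: eq_bigr => C /andP[sHC sC]; rewrite /w.
    have rAH := rank_sub G sA; have rHC := rank_sub G sHC.
    have rCH : (rank G C - rank G H <= #|C| - #|H|)%N.
      have sCH : C :\: H \subset edges (contract G H) by rewrite /= setSD.
      have := leq_rank_card sCH; have := rank_contract sCH.
      rewrite cardsD (setIidPr sHC).
      have -> : C :\: H :|: H = C.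
        by rewrite setDUidr.
      lia.
    have cHC := subset_leq_card sHC.
    rewrite [_ * v ^+ _]mulrC mulrACA -!mulrA -!exprD; congr (_ * (_ * _)).
    (* The ranks of H cancel in the sign, which leaves the parity of #|H|. *)
    rewrite -signr_odd -[RHS]signr_odd; congr (_ ^+ nat_of_bool _).
    rewrite !oddD (oddB rCH) (oddB rAH) (oddB rHC) (oddB cHC).
    by case: odd; case: odd; case: odd; case: odd; case: odd.
  rewrite (exchange_big_dep xpredT) //=; apply: eq_bigr => A _.
  rewrite (exchange_big_dep (fun C => C \subset edges G)) /=; last first.
    by move=> H C _ /andP[].
  apply: eq_bigr => C sC; apply: eq_bigl => H; rewrite sC andbT.
  rewrite andbC; case sHC: (H \subset C); rewrite ?andbF // !andbT.
  by rewrite (subset_trans sHC sC).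
rewrite [RHS]big_mkcond; apply: eq_bigr => A _.
under eq_bigr do rewrite -mulr_sumr.
case: ifP => sA; last first.
  rewrite big1 // => C sC; rewrite big_pred0 ?mulr0 // => H.
  apply/negP=> /andP[sAH sHC]; case/negP: sA.
  exact: subset_trans sAH (subset_trans sHC sC).
rewrite (bigD1 A) //= sum_sign_interval // eqxx big1 ?addr0.
  rewrite /w -mulrA -exprD -[(-1) ^+ _]signr_odd !oddD !addbb mulr1.
  by rewrite mulrC.
move=> C /andP[sC neCA]; have [sAC|nsAC] := boolP (A \subset C).
  by rewrite sum_sign_interval // eq_sym (negPf neCA) mulr0.
rewrite big_pred0 ?mulr0 // => H; apply: contraNF nsAC => /andP[].
exact: subset_trans.
Qed.

End RankPolynomial.

(** * Evaluations of the Tutte polynomial *)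

Section TutteEvaluation.
Variables V E : finType.
Implicit Types (G : mgraph V E) (H : {set E}) (e : E) (a b : {poly int}).

Lemma rank_poly_edgeless (R : comNzRingType) G (u v : R) :
  edges G = set0 -> rank_poly G u v = 1.
Proof.
move=> G0; rewrite /rank_poly G0 (big_pred1 set0) => [|A]; last exact: subset0.
by rewrite /rank_term G0 rank_set0 cards0 mulr1.
Qed.

(** Whitney's expansion satisfies the deletion-contraction rules at every edge,
    so the order in which [tutte_rec] picks the edges does not matter. *)
Lemma tutte_atE G a b : tutte_at G a b = rank_poly G (a - 1) (b - 1).
Proof.
pose ev p := (map_poly (map_poly polyC) p).[a%:P].[b] : {poly int}.
have evD p q : ev (p + q) = ev p + ev q by rewrite /ev rmorphD !hornerD.
have evXM p : ev ('X * p) = a * ev p.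
  by rewrite /ev rmorphM /= map_polyX !hornerM hornerX hornerC.
have evYM p : ev ('X%:P * p) = b * ev p.
  by rewrite /ev rmorphM /= map_polyC /= map_polyX !hornerM hornerC hornerX.
have ev1 : ev 1 = 1 by rewrite /ev rmorph1 !hornerC.
suffices rec n : (#|edges G| <= n)%N ->
    ev (tutte_rec n G) = rank_poly G (a - 1) (b - 1) by exact: rec.
elim: n G => [|n IHn] G leGn.
  by rewrite ev1 rank_poly_edgeless //; apply/eqP; rewrite -cards_eq0 -leqn0.
rewrite /=; case: pickP => [e Ge|G0]; last first.
  by rewrite ev1 rank_poly_edgeless //; apply/setP=> e; rewrite G0 inE.
have leDn : (#|edges (delete G e)| <= n)%N.
  by move: leGn; rewrite /= -setDE (cardsD1 e) Ge.
have leCn : (#|edges (contract G [set e])| <= n)%N.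
  by move: leGn; rewrite /= (cardsD1 e) Ge.
have loop_nbridge : is_loop G e -> ~~ is_bridge G e.
  by move=> /eqP lp; rewrite /is_bridge lp connect0.
case: ifP => [bre|/negbT nbr].
  have nlp : ~~ is_loop G e by apply: contraL bre.
  rewrite evXM IHn // rank_poly_contract //.
  by rewrite (rank_poly_bridge_split _ _ Ge bre) subrK.
case: ifP => [lpe|/negbT nlp].
  rewrite evYM IHn // rank_poly_delete //.
  by rewrite (rank_poly_loop_split _ _ Ge lpe) subrK.
rewrite evD !IHn // rank_poly_contract // rank_poly_delete //.
by rewrite (rank_poly_split _ _ Ge) big_split addrC.
Qed.

Lemma tutte_at_bridge G b e :
  e \in edges G -> is_bridge G e -> tutte_at G 0 b = 0.
Proof.
move=> Ge bre; rewrite tutte_atE (rank_poly_bridge_split _ _ Ge bre) subrK.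
exact: mul0r.
Qed.

Lemma tutte_at_loop G a e :
  e \in edges G -> is_loop G e -> tutte_at G a 0 = 0.
Proof.
move=> Ge lpe; rewrite tutte_atE (rank_poly_loop_split _ _ Ge lpe) subrK.
exact: mul0r.
Qed.

Lemma tutte_at_convolution G a b :
  tutte_at G a b = \sum_(H : {set E} | H \subset edges G)
    tutte_at (restrict G H) 0 b * tutte_at (contract G H) a 0.
Proof.
rewrite tutte_atE -rank_poly_convolution; apply: eq_bigr => H _.
by rewrite !tutte_atE !sub0r.
Qed.

End TutteEvaluation.

(** * Black darts and regions *)

Section Diagram.
Variables (D : diagram) (B : {set {set dart (crossing D)}}).
Hypothesis hB : checkerboard B.
Notation dartD := (dart (crossing D)).
Notation G := (tait hB).
Notation next := (next_corner (@arc D)).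
Implicit Types (x y z : dartD) (c d : crossing D) (H : {set crossing D}).
Implicit Types (s : state D).

(** Leaving along a black dart, one has a black region on the left. *)
Definition black x := region x \in B.

Definition opp x : dartD := (x.1, x.2 + 2).

(** One of the two black corners at c; the other one is [opp (black_dart c)]. *)
Definition black_dart c : dartD := if black (c, 0) then (c, 0) else (c, 1).

Lemma oppK : involutive opp.
Proof.
by case=> c i; rewrite /opp /= -addrA (_ : 2 + 2 = 0) ?addr0 //; apply/eqP.
Qed.

Lemma opp_neq x : (opp x == x) = false.
Proof. by case: x => c [[|[|[|[|?]]]] ?] //; rewrite xpair_eqE eqxx. Qed.

Lemma opp_rot x : opp x = rot (rot x).
Proof. by rewrite /opp /rot /= -addrA; congr (_, _ + _); apply/eqP. Qed.

Lemma rot_next x : rot (next x) = arc x.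
Proof. by rewrite /rot /next_corner /= subrK -surjective_pairing. Qed.

Lemma next_inj : injective next.
Proof. by move=> x y xy; apply: (can_inj (@arcK D)); rewrite -!rot_next xy. Qed.

Lemma region_next x : region (next x) = region x.
Proof.
apply/setP=> y; rewrite !inE; apply/esym/(same_connect (fconnect_sym next_inj)).
exact: fconnect1.
Qed.

Lemma black_rot x : black (rot x) = ~~ black x.
Proof. exact: black_alternate hB x. Qed.

Lemma black_next x : black (next x) = black x.
Proof. by rewrite /black region_next. Qed.

Lemma black_arc x : black (arc x) = ~~ black x.
Proof. by rewrite -rot_next black_rot black_next. Qed.

Lemma black_opp x : black (opp x) = black x.
Proof. by rewrite opp_rot !black_rot negbK. Qed.

Lemma black_black_dart c : black (black_dart c).
Proof.
rewrite /black_dart; case: ifP => [//|/negbT].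
by rewrite -black_rot /rot /= add0r.
Qed.

Lemma black_dart1 c : (black_dart c).1 = c.
Proof. by rewrite /black_dart; case: ifP. Qed.

Lemma black_dartP x : black x ->
  x = black_dart x.1 \/ x = opp (black_dart x.1).
Proof.
have b01 c : black (c, 1) = ~~ black (c, 0) by rewrite -black_rot /rot /= add0r.
have b2 c : black (c, 2) = black (c, 0).
  by rewrite -(black_opp (c, 0)) /opp /= add0r.
have b3 c : black (c, 3) = black (c, 1).
  by rewrite -(black_opp (c, 1)) /opp /=; congr (black (_, _)); apply/eqP.
case: x => c i /=; rewrite /black_dart.
have : i \in [:: 0; 1; 2; 3 : 'Z_4] by case: i => [[|[|[|[|?]]]] ?].
rewrite !inE => /or4P[] /eqP->.
- by move->; left.
- by rewrite b01 => /negPf->; left.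
- by rewrite b2 => ->; right; rewrite /opp /= add0r.
- by rewrite b3 b01 => /negPf->; right; congr (_, _); apply/eqP.
Qed.

Lemma tait_endsE c :
  ends G c = (region (black_dart c), region (opp (black_dart c))).
Proof.
rewrite /= /tait_ends /black_dart /black; case: ifP => _; rewrite /opp /=.
  by rewrite add0r.
by congr (_, region (_, _)); apply/eqP.
Qed.

Lemma linked_opp H x :
  black x -> x.1 \in H -> linked G H (region x) (region (opp x)).
Proof.
move/black_dartP; move: (x.1) => c xE Hc.
have := linked_ends (in_setT c : c \in edges G) Hc; rewrite tait_endsE /=.
by case: xE => ->; rewrite ?oppK // linked_sym.
Qed.

(** * Boundary walks of the black surface *)

Definition cross H x := if black x && (x.1 \in H) then opp x else x.

Lemma crossK H : involutive (cross H).
Proof.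
move=> x; rewrite /cross; case bxH: (black x && (x.1 \in H)); last by rewrite bxH.
by rewrite black_opp bxH oppK.
Qed.

(** On black darts, the boundary of the surface formed by the black regions and a
    band at each crossing in H, followed with that surface on the left.  On white
    darts it runs around the white regions whatever H is: their orbits add a
    constant to the number of orbits. *)
Definition walk H x := cross H (next x).

Lemma walk_inj H : injective (walk H).
Proof. exact: inj_comp (inv_inj (crossK H)) next_inj. Qed.

Definition walk_perm H : {perm dartD} := perm (@walk_inj H).

Definition orbits H := #|porbits (walk_perm H)|.

Lemma black_walk H x : black (walk H x) = black x.
Proof.
by rewrite /walk /cross; case: ifP => _; rewrite ?black_opp black_next.
Qed.

Lemma walk_permE H x : walk_perm H x = walk H x.
Proof. exact: permE. Qed.

Lemma porbit_walk H x : porbit (walk_perm H) (walk H x) = porbit (walk_perm H) x.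
Proof. by rewrite -walk_permE -[RHS](porbit_perm _ 1) expg1. Qed.

(** The black regions met by one boundary walk lie in one component of G|H. *)
Lemma linked_walk H x y : black x -> y \in porbit (walk_perm H) x ->
  linked G H (region x) (region y).
Proof.
move=> bx /porbitP[i ->].
suffices: black ((walk_perm H ^+ i)%g x) &&
    linked G H (region x) (region ((walk_perm H ^+ i)%g x)) by case/andP.
elim: i => [|i]; first by rewrite perm1 bx [linked _ _ _ _]connect0.
rewrite expgSr permM walk_permE black_walk; move: (_ x) => {}y /andP[-> xy] /=.
apply: connect_trans xy _; rewrite -/(linked G H _ _) -(region_next y).
rewrite /walk /cross.
by case: ifP => [/andP[by_ yH]|_]; [apply: linked_opp | apply: connect0].
Qed.

Lemma walk_setU1 H c : c \notin H ->
  walk_perm (c |: H) =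
  (walk_perm H * tperm (black_dart c) (opp (black_dart c)))%g.
Proof.
move=> H'c; apply/permP=> x; rewrite permM !walk_permE /walk.
move: (next x) => {}x; rewrite /cross in_setU1.
have bc := black_black_dart c.
have [xc|/negbTE xc] := eqVneq x.1 c.
  rewrite -xc /= xc (negPf H'c) !andbT andbF.
  case: ifP => [bx|nbx].
    case: (black_dartP bx); rewrite xc => ->; rewrite ?tpermL ?tpermR //.
    by rewrite oppK.
  by rewrite tpermD //; apply: contraFneq nbx => <-; rewrite ?black_opp.
rewrite /= tpermD //; case: ifP => _; apply: contraFneq xc => xE;
  by have := congr1 fst xE; rewrite /= black_dart1 => <-.
Qed.

(** The two black corners at c lie in one orbit: the transposition splits it;
    they lie in two: it merges them. *)
Lemma porbits_swap H c (q : {perm dartD}) :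
    q = (walk_perm H * tperm (black_dart c) (opp (black_dart c)))%g ->
  (#|porbits q| +
     (black_dart c \notin porbit (walk_perm H) (opp (black_dart c))).*2 =
   orbits H + 1)%N.
Proof.
move=> ->; set p := black_dart c.
have := porbits_mul_tperm (walk_perm H)^-1%g p (opp p).
rewrite /= eq_sym opp_neq porbitV porbitsV => <-.
by rewrite -porbitsV invMg tpermV.
Qed.

Lemma orbits_setU1 H c : c \notin H ->
  (orbits (c |: H) +
     (black_dart c \notin porbit (walk_perm H) (opp (black_dart c))).*2 =
   orbits H + 1)%N.
Proof. by move=> H'c; apply/porbits_swap/walk_setU1. Qed.

Lemma orbits_setD1 H c : c \in H ->
  (orbits (H :\ c) +
     (black_dart c \notin porbit (walk_perm H) (opp (black_dart c))).*2 =
   orbits H + 1)%N.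
Proof.
move=> Hc; apply: porbits_swap.
by rewrite -[in RHS](setD1K Hc) walk_setU1 ?setD11 // -mulgA tperm2 mulg1.
Qed.

(** Half of the genus formula, valid on any surface: two corners in unlinked
    regions lie in different orbits, which the new crossing merges. *)
Lemma orbits_rank_sub H H' : H \subset H' ->
  (orbits H' + 2 * rank G H' + #|H| <= orbits H + 2 * rank G H + #|H'|)%N.
Proof.
move: H'; apply: subset_setU1_ind => // c H' _ H'c IH.
have := orbits_setU1 H'c; have := rank_setU1 H' (in_setT c : c \in edges G).
rewrite tait_endsE /= => ->; rewrite cardsU1 H'c.
have := @linked_walk H' (black_dart c) (opp (black_dart c)) (black_black_dart c).
rewrite porbit_sym; case: (_ \in porbit _ _) => [->//|_]; first lia.
by case: linked; lia.
Qed.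

Lemma orbits0 : orbits set0 = #|regions D|.
Proof.
rewrite /orbits /porbits; congr #|pred_of_set _|; apply: eq_imset => x.
apply/setP=> y; rewrite inE; have we z : walk_perm set0 z = next z.
  by rewrite walk_permE /walk /cross inE andbF.
apply/porbitP/idP=> [[i ->]|xy].
  elim: i => [|i IHi]; first by rewrite perm1 connect0.
  by rewrite expgSr permM we; apply: connect_trans IHi (fconnect1 _ _).
exists (findex next x y); rewrite -{1}(iter_findex xy).
by elim: (findex _ _ _) => [|i IHi]; rewrite ?perm1 // expgSr permM we -IHi.
Qed.

(** With all crossings joined, each white region is surrounded by one walk on
    black darts, and by another one on white darts. *)
Lemma orbitsT : (2 * #|regions D :\: B| <= orbits setT)%N.
Proof.
(* The white region beside x, tagged with the side: constant along walks. *)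
pose k x := (black x, if black x then region (arc x) else region x).
have kw x : k (walk_perm setT x) = k x.
  rewrite walk_permE /k black_walk; congr (_, _).
  rewrite /walk /cross black_next in_setT andbT.
  case: (black x); last by rewrite region_next.
  rewrite opp_rot rot_next -(region_next (arc (rot _))); congr region.
  by rewrite /next_corner arcK /= addrK -surjective_pairing.
apply: leq_trans (leq_card_invariant kw).
have <- : #|setX [set: bool] (regions D :\: B)| = (2 * #|regions D :\: B|)%N.
  by rewrite cardsX cardsT card_bool.
rewrite subset_leq_card //; apply/subsetP=> -[b S].
rewrite inE /= in_setT => /setDP[/imsetP[x _ ->{S}]].
rewrite -/(black x) => nbx.
apply/imsetP; exists (if b then arc x else x) => //.
by rewrite /k; case: b; rewrite ?black_arc ?nbx ?arcK // (negPf nbx).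
Qed.

(** * Planarity *)

Hypothesis hconn : diagram_connected D.

(** The Tait graph of a connected diagram is connected: the two ends of an edge of
    the projection graph share the black region beside it. *)
Lemma linked_black x y :
  black x -> black y -> linked G setT (region x) (region y).
Proof.
move=> bx by_; have same z t : black z -> black t -> z.1 = t.1 ->
    linked G setT (region z) (region t).
  move=> bz bt zt; have := linked_opp bz (in_setT z.1).
  case: (black_dartP bz) (black_dartP bt) => -> [] ->;
    by rewrite ?zt ?oppK //= ?black_dart1 => *; rewrite ?[linked _ _ _ _]connect0.
have [b1 b2] := (black_black_dart x.1, black_black_dart y.1).
apply: connect_trans (same _ _ bx b1 _) _; rewrite ?black_dart1 //.
apply: connect_trans (same _ _ b2 by_ _); rewrite ?black_dart1 //.
apply: (connect_homo (f := fun c => region (black_dart c))) (hconn x.1 y.1).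
move=> c d /existsP[i /eqP cd].
suffices [z [bz zc [t [bt td zt]]]] : exists z, [/\ black z, z.1 = c &
    exists t, [/\ black t, t.1 = d & region z = region t]].
  apply: connect_trans (same _ z _ _ _) _;
    rewrite ?black_dart1 ?black_black_dart //.
  by rewrite zt; apply: same; rewrite ?black_dart1 ?black_black_dart.
have [bi|nbi] := boolP (black (c, i)).
  exists (c, i); split=> //; exists (next (c, i)).
  by rewrite black_next region_next.
exists (next (arc (c, i))); rewrite black_next black_arc nbi; split=> //.
  by rewrite /= arcK.
by exists (arc (c, i)); rewrite black_arc nbi region_next.
Qed.

Lemma rank_tait (c : crossing D) : (#|B| <= rank G setT + 1)%N.
Proof.
pose r := fingraph.root (adj (restrict G setT)); pose v := region (black_dart c).
have rE u w : (r u == r w) = linked G setT u w.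
  by rewrite root_connect //; apply: linked_sym.
have leU : (n_comp (adj (restrict G setT)) predT <= 1 + #|~: B|)%N.
  rewrite (@n_comp_image _ _ _ r) => [|u w]; last by rewrite rE.
  apply: leq_trans (_ : #|r v |: r @: ~: B| <= _)%N; last first.
    by rewrite cardsU1 leq_add ?leq_b1 ?leq_imset_card.
  rewrite subset_leq_card //; apply/subsetP=> _ /imsetP[u _ ->].
  rewrite in_setU1; have [Bu|nBu] := boolP (u \in B); last first.
    by rewrite imset_f ?orbT // inE.
  have /imsetP[x _ ux] := subsetP (black_regions hB) u Bu.
  rewrite ux rE; apply/orP; left.
  by apply: linked_black; rewrite ?black_black_dart // /black -ux.
have := cardsC B; rewrite /rank; lia.
Qed.

(** Euler's formula: a connected 4-valent graph has twice as many edges as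
    vertices. *)
Lemma card_regions (c : crossing D) : #|regions D| = (#|crossing D| + 2)%N.
Proof.
have reg : fcard next predT = #|regions D|.
  exact/n_comp_classes/fconnect_sym/next_inj.
have conn : n_comp (crossing_adj (@arc D)) predT = 1%N.
  have cs : connect_sym (crossing_adj (@arc D)) by move=> a b; rewrite !hconn.
  by rewrite -(n_comp_connect cs c); apply: eq_n_comp_r => a; rewrite !inE hconn.
have arcs : (fcard (@arc D) predT * 2 = #|crossing D| * 4)%N.
  rewrite (fcard_order_set (inv_inj (@arcK D))) ?cardX ?card_prod ?card_ord //.
  apply/subsetP=> x _; rewrite inE; apply/eqP.
  apply: (@order_cycle _ _ [:: x; arc x]); rewrite /= ?inE ?arcK ?eqxx //.
  by rewrite eq_sym arc_neq.
by have := arc_planar D; rewrite reg conn; lia.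
Qed.

(** Without handles the two sides of [orbits_rank_sub] agree for the empty set and
    the set of all crossings, hence for all sets in between. *)
Lemma orbits_rank (c : crossing D) H H' : H \subset H' ->
  (orbits H' + 2 * rank G H' + #|H| = orbits H + 2 * rank G H + #|H'|)%N.
Proof.
move=> sHH'.
have := orbits_rank_sub (sub0set H); have := orbits_rank_sub sHH'.
have := orbits_rank_sub (subsetT H'); rewrite orbits0 rank_set0 cards0 cardsT.
have := orbitsT; have := rank_tait c; have := card_regions c.
have := cardsCs B.
have := cardsD (regions D) B; rewrite (setIidPr (black_regions hB)).
have := subset_leq_card (black_regions hB); lia.
Qed.

(** The Jordan curve step: a circuit of black bands through c separates its two
    sides.  Adding c to [H :\ c] keeps the rank, so by [orbits_rank] it has to
    split an orbit. *)
Lemma orbit_nonbridge H c : c \in H -> ~~ is_bridge (restrict G H) c ->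
  black_dart c \notin porbit (walk_perm H) (opp (black_dart c)).
Proof.
move=> Hc /negPn nbr.
have := orbits_rank c (subsetDl H [set c]); have := orbits_setD1 Hc.
have := rank_setU1 (H :\ c) (in_setT c : c \in edges G).
rewrite setD1K // (cardsD1 c H) Hc.
have -> : linked G (H :\ c) (ends G c).1 (ends G c).2.
  move: nbr; apply: connect_sub => u v uv; apply: connect1.
  by move: uv; rewrite /adj /= !setTI setDE.
by case: (_ \in _) => //=; lia.
Qed.

(** The two walks at c run along black components that are not linked. *)
Lemma orbit_nonloop H c : ~~ is_loop (contract G H) c ->
  black_dart c \notin porbit (walk_perm H) (opp (black_dart c)).
Proof.
apply: contra; rewrite porbit_sym => /(linked_walk (black_black_dart c)).
by rewrite -eq_merge /is_loop /=; have /= -> := tait_endsE c.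
Qed.

(** * State circles *)

(** The black corners at c have odd index exactly when the edge c is positive, so
    the parity of a white corner tells the sign of c. *)
Lemma joins_white s c i : ~~ black (c, i) ->
  joins (s c) i = (c \notin state_edges B s).
Proof.
move=> wi.
have par j : black (c, j) = (odd j == ~~ odd i).
  have j_eq : j \in [:: i; i + 1; i + 2; i + 3].
    by case: i j {wi} => [[|[|[|[|?]]]] ?] [[|[|[|[|?]]]] ?].
  have b1 : black (c, i + 1) by rewrite (black_rot (c, i)).
  have b2 : black (c, i + 2) = false by rewrite (black_opp (c, i)) (negPf wi).
  have b3 : black (c, i + 3).
    rewrite -(black_opp (c, i + 1)) in b1; move: b1; rewrite /opp /= -addrA.
    by rewrite (_ : 1 + 2 = 3) //; apply/eqP.
  move: j_eq; rewrite !inE => /or4P[] /eqP->; rewrite ?b1 ?b2 ?b3 ?(negPf wi);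
    by case: i {wi b1 b2 b3} => [[|[|[|[|?]]]] ?].
have -> : (c \in state_edges B s) = (positive B c == s c).
  by rewrite !inE; case: positive; case: (s c).
have -> : positive B c = ~~ odd i.
  apply/forallP/idP=> [/(_ (i + 1))|oi j].
    rewrite -/(black _) (black_rot (c, i)) wi /joins /=.
    by case: i {wi par} => [[|[|[|[|?]]]] ?].
  by rewrite -/(black _) par oi /joins; apply/implyP=> /eqP->.
by rewrite /joins; case: odd; case: (s c).
Qed.

Lemma smoothK r : involutive (smooth r).
Proof. by case: r => -[[|[|[|[|?]]]] ?] //; apply/val_inj. Qed.

Lemma black_smooth r c i : black (c, smooth r i) = ~~ black (c, i).
Proof.
rewrite /smooth; case: ifP => _; last exact: (black_rot (c, i)).
by rewrite -[black (c, i - 1)]negbK -black_rot /rot /= subrK.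
Qed.

(** A state circle that reaches a crossing with a black region on its left goes on
    as [walk] does. *)
Lemma walk_arc_white s x : ~~ black x ->
  walk (state_edges B s) (arc x) = (x.1, smooth (s x.1) x.2).
Proof.
case: x => c i wx; rewrite /walk /next_corner arcK /= /cross /smooth.
rewrite joins_white //.
have -> : black (c, i - 1) by rewrite -[black _]negbK -black_rot /rot /= subrK.
case: (c \in _) => //=; rewrite /opp /= -addrA; congr (_, _ + _); exact/eqP.
Qed.

(** [b] takes each edge of the projection graph to the black one of its two darts;
    the arcs of a state circle turn into steps of [walk], in either direction. *)
Lemma state_circle_porbit s x y : y \in state_circle s x ->
  let b z := if black z then z else arc z in
  porbit (walk_perm (state_edges B s)) (b x) =
  porbit (walk_perm (state_edges B s)) (b y).
Proof.
move=> xy b; pose g := walk_perm (state_edges B s).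
have step z t : state_step s z t -> porbit g (b z) = porbit g (b t).
  case/orP=> /eqP->; first by rewrite /b black_arc; case: ifP; rewrite ?arcK.
  have [bz|wz] := boolP (black z).
    have wt : ~~ black (z.1, smooth (s z.1) z.2).
      by rewrite black_smooth -surjective_pairing bz.
    rewrite /b bz (negPf wt) -[RHS]porbit_walk.
    by rewrite walk_arc_white //= smoothK -surjective_pairing.
  by rewrite /b (negPf wz) -walk_arc_white // black_walk black_arc wz porbit_walk.
move: xy; rewrite inE => /connectP[p].
elim: p x => [|z p IHp] x /=; first by move=> _ ->.
by case/andP=> /step -> /IHp.
Qed.

Lemma state_segment_porbit s c : is_loop (state_graph s) c ->
  black_dart c \in porbit (walk_perm (state_edges B s)) (opp (black_dart c)).
Proof.
rewrite /is_loop /= => /eqP/setP/(_ (c, 2)); rewrite !inE connect0.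
move=> xy; have := @state_circle_porbit s (c, 0) (c, 2).
rewrite inE => /(_ xy) /=.
have -> : (c, 2) = opp (c, 0) by rewrite /opp /= add0r.
rewrite black_opp -eq_porbit_mem.
case: ifP => [b0|/negbT w0]; first by rewrite /black_dart b0 => ->.
(* If the half-edges 0 and 2 are white, one step of [walk] leads from the far ends
   of their edges to the black half-edges 1 and 3. *)
rewrite -porbit_walk -[in RHS]porbit_walk !walk_arc_white ?black_opp //=.
have -> : (c, smooth (s c) 0) =
    if s c then black_dart c else opp (black_dart c).
  by rewrite /black_dart (negPf w0); case: (s c); congr (_, _); apply/eqP.
have -> : (c, smooth (s c) (0 + 2)) =
    if s c then opp (black_dart c) else black_dart c.
  by rewrite /black_dart (negPf w0); case: (s c); congr (_, _); apply/eqP.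
by case: (s c) => ->.
Qed.

Lemma inadequate_phi s : ~~ adequate s -> phi hB s = 0.
Proof.
rewrite negb_forall => /existsP[c]; rewrite negbK => /state_segment_porbit.
rewrite /phi; move: (state_edges B s) => H cyc.
have [Hc|H'c] := boolP (c \in H).
  have brc : is_bridge (restrict G H) c.
    by apply: contraLR cyc; apply: orbit_nonbridge.
  by rewrite (tutte_at_bridge _ _ brc) ?mul0r // !inE Hc.
have lpc : is_loop (contract G H) c.
  by apply: contraLR cyc; apply: orbit_nonloop.
by rewrite [X in _ * X](tutte_at_loop _ _ lpc) ?mulr0 // !inE H'c.
Qed.

Lemma sum_phi : \sum_(s : state D) phi hB s = tutte_at G 'X 'X.
Proof.
rewrite tutte_at_convolution.
(* The state that joins the black regions exactly at the crossings in H. *)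
pose st (H : {set crossing D}) : state D := [ffun c => positive B c == (c \in H)].
have stK : cancel (state_edges B) st.
  move=> s; apply/ffunP=> c; rewrite ffunE !inE.
  by case: positive; case: (s c).
have edgesK : cancel st (state_edges B).
  move=> H; apply/setP=> c; rewrite !inE ffunE.
  by case: positive; case: (c \in H).
rewrite (reindex (state_edges B)); last by exists st => s _.
by apply: eq_bigl => s; rewrite subsetT.
Qed.

End Diagram.

Theorem theorem1p3 (D : diagram) (B : {set {set dart (crossing D)}})
    (hB : checkerboard B) (hconn : diagram_connected D)
    (hcross : (0 < #|crossing D|)%N) :
  tutte_at (tait hB) 'X 'X = \sum_(s : state D | adequate s) phi hB s.
Proof.
rewrite -sum_phi (bigID (@adequate D)) /= [X in _ + X]big1 ?addr0 // => s.
exact: inadequate_phi.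
Qed.
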